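(* Let $k$ be a field with $\mathrm{char}(k)=0$, let $G$ be an additive ordered abelian group and let $\mathcal{F}$ be a family of well-ordered subsets of $G$. Then the $k$-hull $k((\mathcal{F}))$ is a Rayner field if and only if it is a Hahn field in $\mathbb{K}$.
   Context: Ordered abelian groups are totally ordered. $\mathbb{K}=k((G))$ denotes the field of generalised power series with coefficient field $k$ and value group $G$: the set of all functions $s\colon G\to k$ whose support $\mathrm{supp}(s)=\{g\in G\mid s(g)\neq 0\}$ is a well-ordered subset of $G$, with pointwise addition and product $(rs)(g)=\sum_{h\in G}r(h)s(g-h)$. For $g\in G$, $t^g\in\mathbb{K}$ is the function mapping $g$ to $1$ and everything else to $0$. A subfield $K$ of $\mathbb{K}$ is called a Hahn field in $\mathbb{K}$ if $\{\alpha t^g\mid \alpha\in k, g\in G\}\subseteq K$. The $k$-hull of $\mathcal{F}$ in $\mathbb{K}$ is the set $k((\mathcal{F}))=\{a\in\mathbb{K}\mid \mathrm{supp}(a)\in\mathcal{F}\}$. For $A\subseteq G$ and $g\in G$, $A+g=\{a+g\mid a\in A\}$; $\langle A\rangle$ is the subgroup of $G$ generated by $A$; and $\bigoplus_{n\in\mathbb{N}}A=\{\sum_{i=1}^n a_i\mid n\in\mathbb{N}, a_1,\ldots,a_n\in A\}$, where $\mathbb{N}=\{0,1,\ldots\}$ (so the empty sum $0$ is included, and $\bigoplus_{n\in\mathbb{N}}\emptyset=\{0\}$). $G^{\geq 0}=\{g\in G\mid g\geq 0\}$. $\mathcal{F}$ is called a Rayner field family in $G$ if it satisfies all of: (S2)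 $A\in\mathcal{F}$ and $B\subseteq A$ implies $B\in\mathcal{F}$; (S3) $A,B\in\mathcal{F}$ implies $A\cup B\in\mathcal{F}$; (S5) $\mathcal{F}\neq\emptyset$; (A1) $\langle\bigcup_{A\in\mathcal{F}}A\rangle=G$; (A3) $A\in\mathcal{F}$ and $g\in G$ implies $A+g\in\mathcal{F}$; (A4) $A\in\mathcal{F}$ and $A\subseteq G^{\geq 0}$ implies $\bigoplus_{n\in\mathbb{N}}A\in\mathcal{F}$. $k((\mathcal{F}))$ is called a Rayner field if $\mathcal{F}$ is a Rayner field family in $G$. *)

(* Defs.v *)
From HB Require Import structures.
From mathcomp Require Import all_boot all_order all_algebra.
From mathcomp Require Import all_classical.
From mathcomp Require wochoice.

Set Implicit Arguments.
Unset Strict Implicit.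
Unset Printing Implicit Defensive.

Import Order.TTheory GRing.Theory Num.Theory.

Local Open Scope classical_set_scope.
Local Open Scope ring_scope.

(* Ordered abelian groups, on top of MathComp's porderZmodType, which only    *)
(* puts an order and a group law on the same carrier.                         *)
HB.mixin Record isOrderedAbelianGroup G & Num.POrderedZmodule G := {
  oag_total : total (<=%R : rel G);
  oag_leD2r : forall z x y : G, x <= y -> x + z <= y + z }.

#[short(type="oagType")]
HB.structure Definition OrderedAbelianGroup :=
  { G of Num.POrderedZmodule G & isOrderedAbelianGroup G }.

Definition well_ordered (G : oagType) (A : set G) : Prop :=
  wochoice.wo_chain (<=%R : rel G) [in A].

Section OrderTheory.
Variable G : oagType.
Implicit Types (A B C X : set G) (x y z g h : G).

Lemma oag_leD2rE z x y : (x + z <= y + z) = (x <= y).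
Proof.
apply/idP/idP => [|]; last exact: oag_leD2r.
by move/(oag_leD2r (- z)); rewrite !addrK.
Qed.

Lemma oag_ltD2rE z x y : (x + z < y + z) = (x < y).
Proof. by rewrite !lt_neqAle oag_leD2rE (inj_eq (addIr z)). Qed.

Lemma oag_leD2lE z x y : (z + x <= z + y) = (x <= y).
Proof. by rewrite ![z + _]addrC oag_leD2rE. Qed.

Lemma oag_ltD2lE z x y : (z + x < z + y) = (x < y).
Proof. by rewrite ![z + _]addrC oag_ltD2rE. Qed.

Lemma oag_ltNge x y : (x < y) = ~~ (y <= x).
Proof. by have /orP h := oag_total x y; apply: comparable_ltNge; apply/orP. Qed.

Lemma oag_leNgt x y : (x <= y) = ~~ (y < x).
Proof. by rewrite oag_ltNge negbK. Qed.

Lemma well_orderedP A : well_ordered A <->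
  forall B, B `<=` A -> B !=set0 -> exists2 m, B m & forall x, B x -> m <= x.
Proof.
split=> [wA B BA [x Bx]|wA].
  have [||m [[mB mle] _]] := wA [in B]; first by move=> y /set_mem/BA/mem_set.
    by exists x; apply/mem_set.
  by exists m; [exact/set_mem | move=> y By; apply: mle; apply/mem_set].
apply: wochoice.antisymmetric_wo_chain => [x y _ _|B BA [x Bx]].
  exact: le_anti.
have [||m Bm mle] := wA [set y | y \in B].
- by move=> y /= /BA/set_mem.
- by exists x.
by exists m; split.
Qed.

Lemma sub_well_ordered A B : B `<=` A -> well_ordered A -> well_ordered B.
Proof.
move=> BA /well_orderedP wA; apply/well_orderedP => C CB.
by apply: wA; apply: subset_trans BA.
Qed.

Lemma well_ordered0 : well_ordered (set0 : set G).
Proof. by apply/well_orderedP => B B0 [x /B0]. Qed.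

Lemma well_ordered1 g : well_ordered [set g].
Proof.
apply/well_orderedP => B B1 [x Bx]; exists x => // y /B1 ->.
by rewrite (B1 _ Bx).
Qed.

Lemma well_orderedU A B :
  well_ordered A -> well_ordered B -> well_ordered (A `|` B).
Proof.
move=> /well_orderedP wA /well_orderedP wB; apply/well_orderedP => C CAB [x Cx].
have hA := wA (C `&` A) (@subIsetr _ _ _).
have hB := wB (C `&` B) (@subIsetr _ _ _).
have [/hA[a [Ca Aa] la]|nA] := pselect (C `&` A !=set0); last first.
  have CB y : C y -> B y.
    by move=> Cy; case: (CAB _ Cy) => // Ay; case: nA; exists y.
  have [|m [Cm Bm] lm] := hB; first by exists x; split=> //; exact: CB.
  by exists m => // y Cy; apply: lm; split=> //; exact: CB.
have [/hB[b [Cb Bb] lb]|nB] := pselect (C `&` B !=set0); last first.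
  exists a => // y Cy; apply: la; split=> //.
  by case: (CAB _ Cy) => // By; case: nB; exists y.
have /orP[ab|ba] := oag_total a b.
  exists a => // y Cy; case: (CAB _ Cy) => ?; first exact: la.
  by apply: le_trans ab _; exact: lb.
exists b => // y Cy; case: (CAB _ Cy) => ?; last exact: lb.
by apply: le_trans ba _; exact: la.
Qed.

Definition sumset A B : set G := [set a + b | a in A & b in B].

Lemma well_orderedD A B :
  well_ordered A -> well_ordered B -> well_ordered (sumset A B).
Proof.
move=> /well_orderedP wA /well_orderedP wB; apply/well_orderedP => C CAB C0.
apply: contrapT => nomin.
pose P C' b := exists a, [/\ A a, B b, C' (a + b) &
  forall a' b', A a' -> B b' -> C' (a' + b') -> a' + b' < a + b -> b' < b].
have step C' : C' `<=` sumset A B -> C' !=set0 -> exists b, P C' b.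
  move=> C'AB [c Cc].
  have [||a0 [Aa0 [b' Bb' Cab']] a0min] :=
    wA [set a | A a /\ exists2 b, B b & C' (a + b)]; first by move=> ? [].
    have [a Aa [b Bb abc]] := C'AB _ Cc.
    by exists a; split=> //; exists b => //; rewrite abc.
  have [||b0 [Bb0 Cab0] b0min] := wB [set b | B b /\ C' (a0 + b)].
  - by move=> ? [].
  - by exists b'.
  exists b0, a0; split=> // a1 b1 Aa1 Bb1 Cab1.
  have le01 : a0 <= a1 by apply: a0min; split=> //; exists b1.
  rewrite ![_ < _]oag_ltNge; apply: contraNN => le2.
  apply: (@le_trans _ _ (a0 + b1)); first by rewrite oag_leD2lE.
  by rewrite oag_leD2rE.
have [b [a [Aa Bb Cab ab]] bmin] :
    exists2 b, P C b & forall b', P C b' -> b <= b'.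
  apply: (wB (P C)); first by move=> ? [? []].
  exact: step.
have [c [Cc clt]] : exists c, C c /\ c < a + b.
  apply: contrapT => nc; apply: nomin; exists (a + b) => // x Cx.
  by rewrite oag_leNgt; apply/negP => lt; apply: nc; exists x.
have [||b1 [a1 [Aa1 Bb1 [Cab1 lt1] h1]]] := step (C `&` [set x | x < a + b]).
- by move=> x [/CAB].
- by exists c.
have : b1 < b by apply: (ab a1).
rewrite oag_ltNge; apply/negP/negPn/bmin; exists a1; split=> //.
move=> a' b' Aa' Bb' Cab' lt'; apply: (h1 a') => //; split=> //=.
exact: lt_trans lt1.
Qed.

Lemma finite_wo X : well_ordered X ->
    (forall C, C `<=` X -> C !=set0 -> exists2 m, C m & forall x, C x -> x <= m) ->
  finite_set X.
Proof.
move=> /well_orderedP wX mX.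
have [->//|/set0P X0] := eqVneq X set0.
pose I := [set h | X h /\ finite_set (X `&` [set x | x <= h])].
have [m0 Xm0 m0min] := wX _ (@subset_refl _ X) X0.
have [||m [Xm finm] mmax] := mX I; first by move=> ? [].
  exists m0; split=> //; apply: sub_finite_set (finite_set1 m0).
  by move=> x [Xx /= xm]; apply/le_anti; rewrite xm m0min.
have [Xgt0|nXgt] := pselect (X `&` [set x | m < x] !=set0); last first.
  apply: sub_finite_set finm => x Xx; split=> //=.
  by rewrite oag_leNgt; apply/negP => lt; apply: nXgt; exists x.
have [m' [Xm' /= lt'] m'min] := wX _ (@subIsetl _ _ _) Xgt0.
suff /mmax : I m' by rewrite oag_leNgt lt'.
split=> //; apply: (@sub_finite_set _ _ ((X `&` [set x | x <= m]) `|` [set m'])).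
  move=> x [Xx /= xm'].
  have [xm|] := boolP (x <= m); first by left.
  rewrite -oag_ltNge => mx; right; apply/le_anti; rewrite xm' /=.
  exact: m'min.
by rewrite finite_setU; split.
Qed.

Lemma finite_conv A B g : well_ordered A -> well_ordered B ->
  finite_set [set h | A h /\ B (g - h)].
Proof.
move=> wA /well_orderedP wB; apply: finite_wo.
  by apply: sub_well_ordered wA => h [].
move=> C CAB [c Cc].
have [||m [Cm Bm] mmin] := wB [set b | C (g - b) /\ B b].
- by move=> ? [].
- by exists (g - c); split; [rewrite subKr|case: (CAB _ Cc)].
exists (g - m) => // x Cx.
have : m <= g - x by apply: mmin; split; [rewrite subKr|case: (CAB _ Cx)].
by rewrite -(oag_leD2rE (x - m)) addrCA subrr addr0 addrA subrK.
Qed.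

(* Includes the empty sum 0. *)
Definition finite_sums A : set G :=
  [set g | exists n (a : 'I_n -> G), (forall i, A (a i)) /\ g = \sum_(i < n) a i].

Lemma finite_sums0 A : finite_sums A 0.
Proof.
exists 0%N, (fun=> 0); split; last by rewrite big_ord0.
by case.
Qed.

Lemma finite_sumsD A a g : A a -> finite_sums A g -> finite_sums A (a + g).
Proof.
move=> Aa [n [f [fA ->]]].
exists n.+1, (fun i => if unlift ord0 i is Some j then f j else a); split.
  by move=> i; case: unliftP.
rewrite big_ord_recl unlift_none; congr (_ + _).
by apply: eq_bigr => i _; rewrite liftK.
Qed.

(* Neumann's lemma, by a minimal bad sequence argument: an infinite descent    *)
(* xs in finite_sums A, each term using as few summands as possible, is split *)
(* as xs i = (q i).1 + (q i).2 with (q i).1 in A.                             *)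
Lemma well_ordered_sums A : A `<=` [set g | 0 <= g] -> well_ordered A ->
  well_ordered (finite_sums A).
Proof.
move=> A0 /well_orderedP wA; apply/well_orderedP => T0 T0S T0n.
apply: contrapT => nomin.
pose nm (X : set G) := forall x, X x -> exists2 y, X y & y < x.
have nmT0 : nm T0.
  move=> x Tx; apply: contrapT => nx; apply: nomin; exists x => // y Ty.
  by rewrite oag_leNgt; apply/negP => lt; apply: nx; exists y.
pose rep n x := exists a : 'I_n -> G, (forall i, A (a i)) /\ x = \sum_(i < n) a i.
pose D := [set x | exists X, [/\ X `<=` finite_sums A, nm X & X x]].
have DS : D `<=` finite_sums A by move=> x [X [XS _ Xx]]; exact: XS.
have D0 : D !=set0 by case: T0n => x Tx; exists x, T0.
have nmD : nm D.
  by move=> x [X [XS nX Xx]]; have [y Xy yx] := nX _ Xx; exists y => //; exists X.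
have minD (E : set G) : E !=set0 -> E `<=` D -> exists n x,
    [/\ E x, rep n x & forall y m, E y -> rep m y -> (n <= m)%N].
  move=> [x Ex] ED; have [n nx] := DS _ (ED _ Ex).
  have exn : exists n, `[< exists2 x, E x & rep n x >].
    by exists n; apply/asboolP; exists x.
  case: (ex_minnP exn) => m /asboolP[z Ez zr] mmin.
  exists m, z; split=> // y p Ey yr; apply: mmin; apply/asboolP.
  by exists y.
pose Dlt o := if o is Some x then [set y | D y /\ y < x] else D : set G.
have next (o : option G) : exists p : nat * G, (if o is Some x then D x else True) ->
    [/\ Dlt o p.2, rep p.1 p.2 & forall y m, Dlt o y -> rep m y -> (p.1 <= m)%N].
  case: o => [x|].
    have [Dx|nD] := pselect (D x); last by exists (0%N, 0).
    have [||n [z zP]] := minD (Dlt (Some x)); last by exists (n, z).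
      by have [y Dy yx] := nmD _ Dx; exists y.
    by move=> ? [].
  by have [||n [z zP]] := minD (Dlt None) => //; exists (n, z).
have [f fP] := choice next.
pose xs := fix xs i := if i is j.+1 then f (Some (xs j).2) else f None.
have xsD i : D (xs i).2.
  elim: i => [|i ih] /=; first by have [] := fP None I.
  by have [[]] := fP (Some (xs i).2) ih.
pose prev i := if i is j.+1 then Some (xs j).2 else None.
have xsP i : [/\ Dlt (prev i) (xs i).2, rep (xs i).1 (xs i).2 &
    forall y m, Dlt (prev i) y -> rep m y -> ((xs i).1 <= m)%N].
  case: i => [|i] /=; first exact: fP None I.
  exact: fP (Some (xs i).2) (xsD i).
have xslt i : (xs i.+1).2 < (xs i).2 by have [[]] := xsP i.+1.
have xslt' i j : (i < j)%N -> (xs j).2 < (xs i).2.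
  elim: j => // j ih; rewrite ltnS leq_eqVlt => /predU1P[->//|/ih].
  exact: lt_trans.
have [q qP] : exists q : nat -> G * G, forall i, [/\ A (q i).1,
    (xs i).2 = (q i).1 + (q i).2 & exists2 m, ((xs i).1 = m.+1)%N & rep m (q i).2].
  pose Q i (p : G * G) := [/\ A p.1, (xs i).2 = p.1 + p.2 &
    exists2 m, ((xs i).1 = m.+1)%N & rep m p.2].
  suff /choice[q qP] : forall i, exists p, Q i p by exists q.
  move=> i; have [_ + _] := xsP i.
  case E : (xs i).1 => [|m] [a [aA xE]].
    exfalso; have [y Dy] := nmD _ (xsD i).
    have [n [b [bA ->]]] := DS _ Dy.
    rewrite xE big_ord0 oag_ltNge => /negP; apply.
    elim/big_rec: _ => // j z _ z0.
    apply: (le_trans z0); rewrite -{1}[z]add0r oag_leD2rE; exact/A0/bA.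
  exists (a ord0, \sum_(j < m) a (lift ord0 j)); split.
  - exact: aA.
  - by rewrite [LHS]xE big_ord_recl.
  - by exists m => //; exists (fun j => a (lift ord0 j)); split.
have pmin (P : set nat) : P !=set0 ->
    exists2 k, P k & forall j, P j -> (q k).1 <= (q j).1.
  move=> [i Pi].
  have [||m [k Pk km] mmin] := wA [set (q j).1 | j in P].
  - by move=> _ [j _ <-]; case: (qP j).
  - by exists (q i).1, i.
  by exists k => // j Pj; rewrite km; apply: mmin; exists j.
pose K := [set k | forall j, (k <= j)%N -> (q k).1 <= (q j).1].
pose T := [set (q k).2 | k in K].
have TS : T `<=` finite_sums A.
  by move=> _ [k _ <-]; have [_ _ [m _ mr]] := qP k; exists m.
have nmT : nm T.
  move=> _ [k Kk <-].
  have [|k' kk' k'min] := pmin [set j | (k < j)%N]; first by exists k.+1 => /=.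
  exists (q k').2.
    by exists k' => // j k'j; apply: k'min; exact: leq_trans k'j.
  have := xslt' _ _ kk'; have [_ -> _] := qP k; have [_ -> _] := qP k'.
  rewrite ![_ < _]oag_ltNge; apply: contraNN => le.
  apply: (@le_trans _ _ ((q k').1 + (q k).2)).
    by rewrite oag_leD2rE; apply: Kk; exact: ltnW.
  by rewrite oag_leD2lE.
have [k _ kmin] := pmin setT (ex_intro _ 0%N I).
have Dk : D (q k).2 by exists T; split=> //; exists k => // j _; exact: kmin.
have [Aq xE [m mE mr]] := qP k.
have lek : (q k).2 <= (xs k).2.
  by rewrite xE -{1}[(q k).2]add0r oag_leD2rE; exact: A0.
have [_ _ /(_ (q k).2 m)] := xsP k.
rewrite mE ltnn => /(_ _ mr) C; apply: notF; apply: C.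
case: k xE lek Dk {kmin Aq mE mr} => [|k] _ lek Dk //=.
by split=> //; apply: le_lt_trans lek _; exact: xslt.
Qed.

End OrderTheory.

Section FiniteSums.
Variables (I : choiceType) (V : zmodType).

Lemma fsumTE (X : set I) (F : I -> V) : (forall h, ~ X h -> F h = 0) ->
  \sum_(h \in [set: I]) F h = \sum_(h \in X) F h.
Proof. by move=> F0; apply/esym/fsbig_widen => // h [_] /F0. Qed.

Lemma fsumT1 (c : I) (F : I -> V) : (forall h, h != c -> F h = 0) ->
  \sum_(h \in [set: I]) F h = F c.
Proof.
move=> F0; rewrite (@fsumTE [set c]) ?fsbig_set1 // => h /= hc.
by apply: F0; apply/eqP.
Qed.

End FiniteSums.

Section Gps.
Variables (k : fieldType) (G : oagType).
Implicit Types (r s t : G -> k) (g h : G).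

Definition fsupport s : set G := [set g | s g != 0].

(* The field k((G)); its fieldType structure is built below.                  *)
Record gps := Gps {
  gps_fun :> G -> k;
  gps_wo : well_ordered (fsupport gps_fun) }.

(* The sum is \sum_(h in G) with finitely many nonzero terms (finite_conv)    *)
(* as soon as r and s have well-ordered supports.                             *)
Definition conv r s : G -> k := fun g => \sum_(h \in [set: G]) r h * s (g - h).

Definition mono (a : k) (g : G) : G -> k := fun h => if h == g then a else 0.

Lemma fsupport0 : fsupport (fun=> 0) = set0.
Proof. by apply/seteqP; split=> // g; rewrite /fsupport /= eqxx. Qed.

Lemma fsupportN s : fsupport (fun g => - s g) = fsupport s.
Proof. by apply/seteqP; split=> g; rewrite /fsupport /= oppr_eq0. Qed.

Lemma fsupportD r s :
  fsupport (fun g => r g + s g) `<=` fsupport r `|` fsupport s.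
Proof.
move=> g; rewrite /fsupport /=; have [->|] := eqVneq (r g) 0; last by left.
by rewrite add0r; right.
Qed.

Lemma fsupport_mono a g : fsupport (mono a g) `<=` [set g].
Proof. by move=> h; rewrite /fsupport /mono /=; case: (h =P g) => // _; rewrite eqxx. Qed.

Lemma convE X r s g :
    (forall h, r h != 0 -> s (g - h) != 0 -> X h) ->
  conv r s g = \sum_(h \in X) r h * s (g - h).
Proof.
move=> hX; apply: fsumTE => h nX.
have [->|r0] := eqVneq (r h) 0; first by rewrite mul0r.
have [->|s0] := eqVneq (s (g - h)) 0; first by rewrite mulr0.
by case: nX; exact: hX.
Qed.

Lemma conv_neq0 r s g : conv r s g != 0 ->
  exists h, r h != 0 /\ s (g - h) != 0.
Proof.
move=> n0; apply: contrapT => nh; move/eqP: n0; apply.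
rewrite (@convE set0) ?fsbig_set0 // => h rh sh.
by case: nh; exists h.
Qed.

Lemma fsupport_conv r s :
  fsupport (conv r s) `<=` sumset (fsupport r) (fsupport s).
Proof.
move=> g /conv_neq0[h [rh sh]]; exists h => //; exists (g - h) => //.
by rewrite addrC subrK.
Qed.

Lemma gps_wo0 : well_ordered (fsupport (fun=> 0)).
Proof. rewrite fsupport0; exact: well_ordered0. Qed.

Lemma gps_woN (a : gps) : well_ordered (fsupport (fun g => - a g)).
Proof. rewrite fsupportN; exact: gps_wo. Qed.

Lemma gps_woD (a b : gps) : well_ordered (fsupport (fun g => a g + b g)).
Proof.
by apply: sub_well_ordered (@fsupportD _ _) (well_orderedU _ _); exact: gps_wo.
Qed.

Lemma gps_woM (a b : gps) : well_ordered (fsupport (conv a b)).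
Proof.
by apply: sub_well_ordered (@fsupport_conv _ _) (well_orderedD _ _); exact: gps_wo.
Qed.

Lemma gps_wo_mono a g : well_ordered (fsupport (mono a g)).
Proof. exact: sub_well_ordered (@fsupport_mono _ _) (@well_ordered1 _ _). Qed.

Definition gps_zero := Gps gps_wo0.
Definition gps_opp a := Gps (@gps_woN a).
Definition gps_add a b := Gps (@gps_woD a b).
Definition gps_mul a b := Gps (@gps_woM a b).
(* alpha t^g *)
Definition gps_mono alpha g := Gps (@gps_wo_mono alpha g).

Lemma gpsP (a b : gps) : a =1 b -> a = b.
Proof.
case: a b => [a wa] [b wb] /= /funext ab.
by case: b / ab wb => wb; rewrite (Prop_irrelevance wa wb).
Qed.

HB.instance Definition _ := gen_eqMixin gps.
HB.instance Definition _ := gen_choiceMixin gps.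

Lemma gps_addA : associative gps_add.
Proof. by move=> a b c; apply: gpsP => g; apply: addrA. Qed.

Lemma gps_addC : commutative gps_add.
Proof. by move=> a b; apply: gpsP => g; apply: addrC. Qed.

Lemma gps_add0 : left_id gps_zero gps_add.
Proof. by move=> a; apply: gpsP => g; apply: add0r. Qed.

Lemma gps_addN : left_inverse gps_zero gps_opp gps_add.
Proof. by move=> a; apply: gpsP => g; apply: addNr. Qed.

HB.instance Definition _ :=
  GRing.isZmodule.Build gps gps_addA gps_addC gps_add0 gps_addN.

Lemma conv_finite (a b : gps) g :
  finite_set [set h | a h != 0 /\ b (g - h) != 0].
Proof. by apply: (@finite_conv _ (fsupport a) (fsupport b)); exact: gps_wo. Qed.

Lemma gps_mulC : commutative gps_mul.
Proof.
move=> a b; apply: gpsP => g /=; rewrite /conv.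
rewrite (reindex_fsbigT (fun h => g - h)); last first.
  by exists (fun h => g - h) => h; rewrite subKr.
by apply: eq_fsbigr => h _; rewrite subKr mulrC.
Qed.

Lemma gps_mulDl : left_distributive gps_mul gps_add.
Proof.
move=> a b c; apply: gpsP => g /=.
pose X := [set h | a h != 0 /\ c (g - h) != 0] `|`
          [set h | b h != 0 /\ c (g - h) != 0].
have fX : finite_set X by rewrite finite_setU; split; exact: conv_finite.
rewrite !(@convE X).
- rewrite -fsbig_split //=; apply: eq_fsbigr => h _; exact: mulrDl.
- by move=> h ah ch; right.
- by move=> h ah ch; left.
- by move=> h /fsupportD[] ah ch; [left|right].
Qed.

Lemma gps_mulA : associative gps_mul.
Proof.
move=> a b c; apply: gpsP => g /=.
pose L := [set l | fsupport a l /\ sumset (fsupport b) (fsupport c) (g - l)].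
pose H := [set h | sumset (fsupport a) (fsupport b) h /\ fsupport c (g - h)].
have fL : finite_set L.
  apply: finite_conv; first exact: gps_wo.
  by apply: well_orderedD; exact: gps_wo.
have fH : finite_set H.
  apply: finite_conv; last exact: gps_wo.
  by apply: well_orderedD; exact: gps_wo.
rewrite (@convE L); last first.
  by move=> h ah bch; split=> //; exact: fsupport_conv.
rewrite (@convE H); last first.
  by move=> h abh ch; split=> //; exact: fsupport_conv.
transitivity (\sum_(l \in L) \sum_(h \in H) a l * (b (h - l) * c (g - h))).
  apply: eq_fsbigr => l /set_mem[al _].
  rewrite -(@mulr_fsumr k); congr (_ * _).
  rewrite /conv (reindex_fsbigT (fun h => h - l)); last first.
    by exists (fun h => h + l) => h; rewrite (addrK, subrK).
  under eq_fsbigr do rewrite opprB subrKA.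
  apply: fsumTE => h nH.
  have [->|b0] := eqVneq (b (h - l)) 0; first by rewrite mul0r.
  have [->|c0] := eqVneq (c (g - h)) 0; first by rewrite mulr0.
  case: nH; split=> //; exists l => //; exists (h - l) => //.
  by rewrite addrC subrK.
rewrite exchange_fsbig //; apply: eq_fsbigr => h /set_mem[_ ch].
rewrite (@convE L); last first.
  move=> l al bl; split=> //; exists (h - l) => //; exists (g - h) => //.
  by rewrite addrC subrKA.
by rewrite mulr_fsuml; apply: eq_fsbigr => l _; rewrite mulrA.
Qed.

Lemma gps_mul_mono alpha c (a : gps) g :
  gps_mul (gps_mono alpha c) a g = alpha * a (g - c).
Proof.
rewrite /= /conv (@fsumT1 _ _ c) /mono ?eqxx // => h /negPf ->.
by rewrite mul0r.
Qed.

Definition gps_one := gps_mono 1 0.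

Lemma gps_mul1 : left_id gps_one gps_mul.
Proof. by move=> a; apply: gpsP => g; rewrite gps_mul_mono mul1r subr0. Qed.

Lemma gps_one_neq0 : gps_one != 0.
Proof.
apply/eqP => /(congr1 (fun a : gps => a 0)) /=; rewrite /mono eqxx.
exact/eqP/oner_neq0.
Qed.

HB.instance Definition _ := GRing.Zmodule_isComNzRing.Build gps
  gps_mulA gps_mulC gps_mul1 gps_mulDl gps_one_neq0.

Lemma gpsD (a b : gps) g : (a + b) g = a g + b g. Proof. by []. Qed.
Lemma gpsN (a : gps) g : (- a) g = - a g. Proof. by []. Qed.
Lemma gpsM (a b : gps) : (a * b) = conv a b :> (G -> k). Proof. by []. Qed.
Lemma gps0E g : (0 : gps) g = 0. Proof. by []. Qed.
Lemma gps1E g : (1 : gps) g = (g == 0)%:R.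
Proof. by rewrite /= /mono; case: eqP. Qed.

Lemma well_ordered_wf (S : set G) : well_ordered S ->
  well_founded (fun x y => [/\ S x, S y & x < y]).
Proof.
move=> /well_orderedP wS x; apply: contrapT => nx.
have [||m [Sm nm] mmin] :=
  wS [set y | S y /\ ~ Acc (fun x y => [/\ S x, S y & x < y]) y].
- by move=> ? [].
- exists x; split=> //; apply: contrapT => nSx; apply: nx; constructor.
  by move=> y [_ /nSx].
apply: nm; constructor => y [Sy _ ym]; apply: contrapT => ny.
by have := mmin y (conj Sy ny); rewrite oag_leNgt ym.
Qed.

Lemma gps_geometric (e : gps) : fsupport e `<=` [set g | 0 < g] ->
  exists2 b : gps, fsupport b `<=` finite_sums (fsupport e) & (1 - e) * b = 1.
Proof.
move=> e0; pose S := finite_sums (fsupport e).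
have wS : well_ordered S.
  apply: well_ordered_sums; last exact: gps_wo.
  by move=> g /e0 /= /ltW.
pose step g (b : forall h, [/\ S h, S g & h < g] -> k) : k :=
  if `[< S g >] then (g == 0)%:R + \sum_(h \in [set: G]) e h *
    (if pselect [/\ S (g - h), S g & g - h < g] is left p then b _ p else 0)
  else 0.
pose b := Fix (well_ordered_wf wS) (fun=> k) step.
have bE g : b g = step g (fun h _ => b h).
  rewrite /b Fix_eq // => x f f' ff'; congr step.
  by apply: functional_extensionality_dep => y; apply: funext => p.
have bS : fsupport b `<=` S.
  move=> g; rewrite /fsupport /= bE /step.
  by case: asboolP => // _; rewrite eqxx.
have bS0 g : ~ S g -> b g = 0 by move=> nS; apply/eqP/negPn/negP => /bS.
pose bb := Gps (sub_well_ordered bS wS).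
exists bb => //; rewrite mulrBl mul1r; apply/eqP; rewrite subr_eq; apply/eqP.
apply: gpsP => g; rewrite gpsD gps1E /= bE /step.
case: asboolP => Sg.
  congr (_ + _); apply: eq_fsbigr => h _.
  have [->|eh] := eqVneq (e h) 0; first by rewrite !mul0r.
  case: pselect => // nS; rewrite (bS0 (g - h)) // => Sgh; apply: nS.
  split=> //; rewrite -(oag_ltD2rE h) subrK -{1}[g]addr0 oag_ltD2lE.
  exact: e0.
have -> : (g == 0) = false.
  by apply/eqP => g0; apply: Sg; rewrite g0; exact: finite_sums0.
rewrite add0r; apply/esym/eqP/negPn/negP => /conv_neq0[h [eh /bS bh]].
by apply: Sg; rewrite -(subrK h g) addrC; exact: finite_sumsD.
Qed.

Lemma gps_unit (a : gps) : a != 0 -> exists b : gps, b * a = 1.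
Proof.
move=> a0; have /well_orderedP wa := @gps_wo a.
have [|v av vmin] := wa _ (@subset_refl _ _).
  apply: contrapT => na; case/eqP: a0; apply: gpsP => g.
  by apply/eqP/negPn/negP => ag; apply: na; exists g.
pose m : gps := gps_mono (a v)^-1 (- v).
have mE g : (m * a) g = (a v)^-1 * a (g + v).
  by rewrite gps_mul_mono opprK.
have [|b _ bP] := @gps_geometric (1 - m * a).
  move=> g agn0; have n0 : (1 - m * a) g != 0 := agn0.
  rewrite gpsD gpsN gps1E mE in n0 => {agn0}; rewrite /=.
  have [g0|g0] := eqVneq g 0.
    by move: n0; rewrite g0 eqxx add0r mulVf // subrr eqxx.
  rewrite (negPf g0) sub0r oppr_eq0 mulf_eq0 negb_or in n0.
  case/andP: n0 => _ /vmin; rewrite -{1}[v]add0r oag_leD2rE => gge0.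
  by rewrite lt_neqAle eq_sym g0.
by exists (b * m); rewrite -mulrA mulrC -[m * a](subKr 1).
Qed.

Definition gps_inv (a : gps) : gps :=
  if pselect (exists b : gps, b * a = 1) is left e then projT1 (cid e) else 0.

Lemma gps_mulVf (a : gps) : a != 0 -> gps_inv a * a = 1.
Proof.
move=> /gps_unit ea; rewrite /gps_inv; case: pselect => // e; exact: projT2 (cid e).
Qed.

Lemma gps_inv0 : gps_inv 0 = 0.
Proof.
rewrite /gps_inv; case: pselect => // e; exfalso; case: e => b.
by rewrite mulr0 => /esym/eqP; rewrite oner_eq0.
Qed.

HB.instance Definition _ := GRing.ComNzRing_isField.Build gps gps_mulVf gps_inv0.

End Gps.

Definition translate (G : oagType) (A : set G) (g : G) : set G :=
  [set a + g | a in A].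

Definition generated_subgroup (G : oagType) (A : set G) : set G :=
  smallest (fun H : set G => zmod_closed [in H]) A.

Record rayner_field_family (G : oagType) (F : set (set G)) : Prop := {
  rayner_sub : forall A B, F A -> B `<=` A -> F B;
  rayner_setU : forall A B, F A -> F B -> F (A `|` B);
  rayner_nonempty : F !=set0;
  rayner_gen : generated_subgroup (\bigcup_(A in F) A) = [set: G];
  rayner_translate : forall A g, F A -> F (translate A g);
  rayner_sums : forall A, F A -> A `<=` [set g | 0 <= g] -> F (finite_sums A) }.

Definition hull (k : fieldType) (G : oagType) (F : set (set G)) :
  set (gps k G) := [set a | F (fsupport a)].
Arguments hull k {G} F.

Definition subfield (L : fieldType) (K : set L) : Prop :=
  GRing.divring_closed [in K].

Definition hahn_field (k : fieldType) (G : oagType) (K : set (gps k G)) : Prop :=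
  subfield K /\ [set gps_mono alpha g | alpha in [set: k] & g in [set: G]] `<=` K.

(* Main.v *)
Require Import Defs.
From HB Require Import structures.
From mathcomp Require Import all_boot all_order all_algebra.
From mathcomp Require Import all_classical.

(** Both directions rest on the geometric series: a nonzero series factors as
    [alpha t^v (1 - e)] with [e] supported in the positive elements of [G], and
    [(1 - e)^-1], the sum of the powers of [e], is supported in
    [finite_sums (fsupport e)].

    If [F] is a Rayner field family, then [(A4)] applied to the empty set puts
    [{0}] in [F], hence [F] contains all singletons by translation, and the hull
    contains all monomials. It is closed under products because two
    well-ordered sets can be translated into the nonnegative elements, where
    their sum lies in [finite_sums] of their union ([rayner_sumset]); it is
    closed under inverses by the factorisation above ([hull_inv]).

    Conversely, let the hull be a Hahn field. Membership of a series in the hull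
    depends only on its support, so for [A] in [F] every choice of nonzero
    coefficients on [A] gives an element of the hull ([hull_coefs]). As [2 != 0]
    in [k], a suitable difference of two series supported on [A] has any
    prescribed subset of [A] as support, and the sum of the indicator series of
    [A] and [B] has support exactly the union. Multiplication by [t^g]
    translates supports. For [(A4)], let [e] be the indicator series of
    [A] without [0]: the coefficient of [(1 - e)^-1] at [g] counts the tuples
    from that set with sum [g], so it is a positive integer at each [g] in
    [finite_sums A], and nonzero in characteristic zero
    ([fsupport_geometric]). *)

Set Implicit Arguments.
Unset Strict Implicit.
Unset Printing Implicit Defensive.

Import Order.TTheory GRing.Theory Num.Theory.
Local Open Scope classical_set_scope.
Local Open Scope ring_scope.

(** * Finite sums and translates in an ordered abelian group *)

Section Sums.
Variable G : oagType.
Implicit Types (A B : set G) (a b g : G).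

Lemma finite_sums_sub A B : A `<=` B -> finite_sums A `<=` finite_sums B.
Proof. by move=> AB g [n [f [fA ->]]]; exists n, f; split=> // i; exact/AB. Qed.

Lemma finite_sums1 A a : A a -> finite_sums A a.
Proof.
by move=> Aa; rewrite -[a]addr0; apply: finite_sumsD => //; exact: finite_sums0.
Qed.

Lemma finite_sums_set0 : finite_sums (set0 : set G) = [set 0].
Proof.
apply/seteqP; split=> [g [[|n] [f [fA ->]]]|_ ->]; last exact: finite_sums0.
  by rewrite big_ord0.
by case: (fA ord0).
Qed.

Lemma finite_sums_inv A g : finite_sums A g ->
  g = 0 \/ exists a, A a /\ finite_sums A (g - a).
Proof.
move=> [[|n] [f [fA ->]]]; first by left; rewrite big_ord0.
right; exists (f ord0); split=> //; rewrite big_ord_recl addrC addKr.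
by exists n, (fun i => f (lift ord0 i)).
Qed.

Lemma finite_sumsD10 A : finite_sums (A `\ 0) = finite_sums A.
Proof.
apply/seteqP; split=> [|g [n [f [fA ->]]]].
  by apply: finite_sums_sub => g [].
elim: n f fA => [|n IH] f fA; first by rewrite big_ord0; exact: finite_sums0.
rewrite big_ord_recl.
have IHn := IH (fun i => f (lift ord0 i)) (fun i => fA _).
have [->|f0] := eqVneq (f ord0) 0; first by rewrite add0r.
by apply: finite_sumsD => //; split=> //; exact/eqP.
Qed.

Lemma translateP A g h : translate A g h <-> A (h - g).
Proof.
split=> [[a Aa <-]|Ahg]; first by rewrite addrK.
by exists (h - g) => //; rewrite subrK.
Qed.

Lemma translate1 g : translate [set 0] g = [set g].
Proof. by rewrite /translate image_set1 add0r. Qed.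

(** The translation is by the opposite of the minimum. *)
Lemma translate_ge0 A : well_ordered A ->
  exists g, translate A g `<=` [set h | 0 <= h].
Proof.
move=> /well_orderedP wA; have [->|/set0P A0] := eqVneq A set0.
  by exists 0 => h /translateP.
have [m _ mmin] := wA A (@subset_refl _ _) A0.
by exists (- m) => h /translateP /mmin; rewrite -(oag_leD2rE (- m)) subrr subrK.
Qed.

End Sums.

(** * Supports of power series and of the geometric series *)

Section Series.
Variables (k : fieldType) (G : oagType).
Implicit Types (A S : set G) (a b e : gps k G) (g : G).

Lemma fsupport_one : fsupport (1 : gps k G) = [set 0].
Proof.
apply/seteqP; split=> g; rewrite /fsupport /mkset; rewrite gps1E.
  by case: (g =P 0) => // _; rewrite eqxx.
by move=> ->; rewrite eqxx oner_neq0.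
Qed.

Lemma fsupport_mono1M a g : fsupport (gps_mono 1 g * a) = translate (fsupport a) g.
Proof.
apply/seteqP; split=> h; last move/translateP; rewrite /fsupport /mkset.
  by rewrite gps_mul_mono mul1r => ahg; apply/translateP.
by move=> ahg; rewrite gps_mul_mono mul1r.
Qed.

Lemma gps_of_coefs A (c : G -> k) : well_ordered A ->
  exists a, forall g, a g = if `[< A g >] then c g else 0.
Proof.
move=> wA; have wc : well_ordered (fsupport (fun g => if `[< A g >] then c g else 0)).
  apply: sub_well_ordered wA => g; rewrite /fsupport /mkset.
  by case: asboolP => //; rewrite eqxx.
by exists (Gps wc).
Qed.

(** The monomial is the inverse of the leading term [a v t^v]. *)
Lemma gps_factor a : a != 0 -> exists alpha v,
  fsupport (1 - gps_mono alpha v * a) `<=` [set g | 0 < g].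
Proof.
move=> a0; have /well_orderedP wa := @gps_wo _ _ a.
have [|v av vmin] := wa _ (@subset_refl _ _).
  apply: contrapT => na; case/eqP: a0; apply: gpsP => g.
  by apply/eqP/negPn/negP => ag; apply: na; exists g.
exists (a v)^-1, (- v) => g eg.
have : (1 - gps_mono (a v)^-1 (- v) * a) g != 0 by exact: eg.
rewrite gpsD gpsN gps1E gps_mul_mono opprK /=.
have [->|g0] := eqVneq g 0; first by rewrite add0r mulVf // subrr eqxx.
rewrite sub0r oppr_eq0 mulf_eq0 negb_or => /andP[_ /vmin].
by rewrite -{1}[v]add0r oag_leD2rE lt_neqAle eq_sym g0.
Qed.

(** Comparing coefficients in [b = 1 + e * b] gives the recursion
    [b g = (g == 0) + \sum_h e h * b (g - h)]. By well-founded induction its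
    terms are natural numbers, and one of them is positive: the first one if
    [g = 0], otherwise one given by splitting a summand off [g]. *)
Lemma fsupport_geometric A e b : [pchar k] =i pred0 ->
    well_ordered A -> A `<=` [set g | 0 < g] ->
    (forall g, e g = if `[< A g >] then 1 else 0) ->
    (1 - e) * b = 1 -> fsupport b `<=` finite_sums A ->
  fsupport b = finite_sums A.
Proof.
move=> hk wA A0 eE eb bS; apply/seteqP; split=> // g Sg.
have wS : well_ordered (finite_sums A).
  by apply: well_ordered_sums => // h /A0 /ltW.
suff [n ng] : exists n, b g = n.+1%:R.
  by rewrite /fsupport /mkset ng ((pcharf0P k).1 hk).
elim/(well_founded_ind (well_ordered_wf wS)): g Sg => g IH Sg.
have bE : b g = (g == 0)%:R + (e * b) g.
  by rewrite -gps1E -eb mulrBl mul1r -gpsD subrK.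
pose X := [set h | e h != 0 /\ b (g - h) != 0].
have fX : finite_set X by exact: conv_finite.
have eA h : e h != 0 -> A h by rewrite eE; case: asboolP => //; rewrite eqxx.
have natX h : X h -> exists n, e h * b (g - h) = n.+1%:R.
  move=> [/eA Ah /bS Sgh]; rewrite eE asboolT // mul1r; apply: IH => //.
  by split=> //; rewrite -(oag_ltD2rE h) subrK -{1}[g]addr0 oag_ltD2lE; exact: A0.
have natsum Y : finite_set Y -> Y `<=` X ->
    exists n, \sum_(h \in Y) e h * b (g - h) = n%:R.
  move=> fY YX; rewrite fsbig_finite //= big_seq.
  apply: (big_ind (fun x : k => exists n, x = n%:R)).
  - by exists 0%N.
  - by move=> _ _ [m ->] [n ->]; exists (m + n)%N; rewrite natrD.
  move=> h; rewrite in_fset_set // => /set_mem/YX/natX[n ->].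
  by exists n.+1.
have sumE : (e * b) g = \sum_(h \in X) e h * b (g - h).
  by rewrite gpsM (@convE _ _ X).
have [g0|[a [Aa Sga]]] := finite_sums_inv Sg.
  have [n nE] := natsum X fX (@subset_refl _ _).
  by exists n; rewrite bE sumE nE g0 eqxx -natrD.
have Xa : X a.
  rewrite /X /= eE asboolT // oner_neq0; split=> //.
  have [|n ->] := IH (g - a) _ Sga; last by rewrite ((pcharf0P k).1 hk).
  by split=> //; rewrite -(oag_ltD2rE a) subrK -{1}[g]addr0 oag_ltD2lE; exact: A0.
have [m mE] := natX a Xa.
have [||n nE] := natsum (X `\ a); [exact: finite_setD|by move=> h []|].
exists ((g == 0%R) + (m + n))%N.
rewrite bE sumE (fsbigD1 a) //= mE nE -!natrD; congr (_%:R).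
by rewrite addSn addnS.
Qed.

End Series.

(** * The hull of a Rayner field family is a Hahn field *)

Section RaynerToHahn.
Variables (k : fieldType) (G : oagType) (F : set (set G)).
Hypothesis F_wo : forall A, F A -> well_ordered A.
Hypothesis F_rayner : rayner_field_family F.
Implicit Types (A B : set G) (a b : gps k G).

(** The empty sum is what makes [(A4)] yield [{0}] from the empty set. *)
Lemma rayner_set1 g : F [set g].
Proof.
have [A FA] := rayner_nonempty F_rayner.
have F0 : F set0 by exact: (rayner_sub F_rayner FA).
rewrite -translate1; apply: (rayner_translate F_rayner).
by rewrite -finite_sums_set0; exact: (rayner_sums F_rayner).
Qed.

Lemma rayner_sumset A B : F A -> F B -> F (sumset A B).
Proof.
move=> FA FB.
have [u A0] := translate_ge0 (F_wo FA); have [v B0] := translate_ge0 (F_wo FB).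
pose C := translate A u `|` translate B v.
have FC : F (finite_sums C).
  apply: (rayner_sums F_rayner); last by rewrite subUset.
  by apply: (rayner_setU F_rayner); exact: (rayner_translate F_rayner).
apply: (rayner_sub F_rayner (rayner_translate F_rayner (- (u + v)) FC)).
move=> _ [x Ax [y By <-]]; apply/translateP; rewrite opprK addrACA.
apply: finite_sumsD; first by left; exists x.
by apply: finite_sums1; right; exists y.
Qed.

Lemma hull_sub a b : hull k F a -> hull k F b -> hull k F (a - b).
Proof.
move=> Fa Fb; apply: (rayner_sub F_rayner (rayner_setU F_rayner Fa Fb)).
by rewrite -(fsupportN b); exact: fsupportD.
Qed.

Lemma hull_mul a b : hull k F a -> hull k F b -> hull k F (a * b).
Proof.
move=> Fa Fb; apply: (rayner_sub F_rayner (rayner_sumset Fa Fb)).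
exact: fsupport_conv.
Qed.

Lemma hull_mono alpha g : hull k F (gps_mono alpha g).
Proof. exact: (rayner_sub F_rayner (rayner_set1 g) (@fsupport_mono _ _ _ _)). Qed.

Lemma hull_inv a : hull k F a -> hull k F a^-1.
Proof.
move=> Fa; have [->|a0] := eqVneq a 0.
  rewrite invr0; apply: (rayner_sub F_rayner (rayner_set1 0)).
  by move=> g; rewrite /fsupport /mkset eqxx.
have [alpha [v epos]] := gps_factor a0.
set m := gps_mono alpha v in epos.
have Fe : hull k F (1 - m * a).
  by apply: hull_sub; [|apply: hull_mul => //]; exact: hull_mono.
have [b bS] := gps_geometric epos; rewrite subKr => mab.
have Fb : hull k F b.
  apply: (rayner_sub F_rayner) bS; apply: (rayner_sums F_rayner) => //.
  by move=> g /epos /ltW.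
have -> : a^-1 = b * m.
  by apply: (mulIf a0); rewrite mulVf // -mulrA mulrC mab.
by apply: hull_mul => //; exact: hull_mono.
Qed.

Lemma hahn_field_of_rayner : hahn_field (hull k F).
Proof.
split; last by move=> _ [alpha _ [g _ <-]]; exact: hull_mono.
split=> [|a b /set_mem Fa /set_mem Fb|a b /set_mem Fa /set_mem Fb].
- by apply: mem_set; exact: hull_mono.
- by apply: mem_set; exact: hull_sub.
- by apply: mem_set; apply: hull_mul => //; exact: hull_inv.
Qed.

End RaynerToHahn.

(** * A hull that is a Hahn field comes from a Rayner field family *)

Section HahnToRayner.
Variables (k : fieldType) (G : oagType) (F : set (set G)).
Hypothesis k_pchar0 : [pchar k] =i pred0.
Hypothesis F_wo : forall A, F A -> well_ordered A.
Hypothesis F_hahn : hahn_field (hull k F).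
Implicit Types (A B : set G) (a b : gps k G).

Let natr_neq0 n : n.+1%:R != 0 :> k.
Proof. by rewrite ((pcharf0P k).1 k_pchar0). Qed.

Let hahn_one : hull k F 1.
Proof. by have [[/set_mem]] := F_hahn. Qed.

Let hahn_sub a b : hull k F a -> hull k F b -> hull k F (a - b).
Proof.
by move=> Fa Fb; have [[_ + _] _] := F_hahn => /(_ a b (mem_set Fa) (mem_set Fb))/set_mem.
Qed.

Let hahn_div a b : hull k F a -> hull k F b -> hull k F (a / b).
Proof.
by move=> Fa Fb; have [[_ _ +] _] := F_hahn => /(_ a b (mem_set Fa) (mem_set Fb))/set_mem.
Qed.

Let hahn_mul a b : hull k F a -> hull k F b -> hull k F (a * b).
Proof.
by move=> Fa Fb; rewrite -[b]invrK -[b^-1]div1r; do 2?apply: hahn_div.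
Qed.

Let hahn_mono alpha g : hull k F (gps_mono alpha g).
Proof. by have [_] := F_hahn; apply; exists alpha => //; exists g. Qed.

(** Any choice of nonzero coefficients is allowed, because the hull only sees
    supports; the closure properties of [F] come from combining
    suitable choices. *)
Lemma hull_coefs A (c : G -> k) : F A -> (forall g, c g != 0) ->
  exists2 a, hull k F a & forall g, a g = if `[< A g >] then c g else 0.
Proof.
move=> FA c0; have [a aE] := gps_of_coefs c (F_wo FA).
exists a => //; rewrite /hull /=.
suff -> : fsupport a = A by [].
apply/seteqP; split=> g; rewrite /fsupport /mkset aE; case: asboolP => // _.
by rewrite eqxx.
Qed.

(** The series with coefficient [2] on [B] and [1] on the rest of [A], minus
    the indicator series of [A], is the indicator series of [B]. *)
Lemma hahn_subset A B : F A -> B `<=` A -> F B.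
Proof.
move=> FA BA.
have [a Fa aE] := hull_coefs FA (fun=> oner_neq0 k).
have [|b Fb bE] := @hull_coefs A (fun g => if `[< B g >] then 2 else 1) FA.
  by move=> g; case: asboolP => _; rewrite ?natr_neq0 ?oner_neq0.
suff <- : fsupport (b - a) = B by exact: hahn_sub.
have baE g : (b - a) g = if `[< B g >] then 1 else 0.
  rewrite gpsD gpsN aE bE; case: (asboolP (B g)) => Bg.
    by rewrite asboolT ?addrK //; exact: BA.
  by rewrite subrr.
apply/seteqP; split=> g; rewrite /fsupport /mkset baE; case: asboolP => //.
  by rewrite eqxx.
by rewrite oner_neq0.
Qed.

Lemma hahn_setU A B : F A -> F B -> F (A `|` B).
Proof.
move=> FA FB.
have [a Fa aE] := hull_coefs FA (fun=> oner_neq0 k).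
have [|b Fb bE] := @hull_coefs B (fun=> -1) FB.
  by move=> g; rewrite oppr_eq0 oner_neq0.
suff <- : fsupport (a - b) = A `|` B by exact: hahn_sub.
apply/seteqP; split=> g; rewrite /fsupport /mkset gpsD gpsN aE bE.
  case: asboolP => Ag; first by left.
  by case: asboolP => Bg; [right|rewrite subrr eqxx].
case: asboolP => Ag; case: asboolP => Bg; rewrite ?opprK ?subr0 ?add0r.
- by move=> _; exact: (natr_neq0 1).
- by rewrite oner_neq0.
- by rewrite oner_neq0.
- by case.
Qed.

Lemma hahn_set1 g : F [set g].
Proof.
rewrite -translate1 -(fsupport_one k) -fsupport_mono1M.
exact: hahn_mul.
Qed.

Lemma hahn_translate A g : F A -> F (translate A g).
Proof.
move=> FA; have [a Fa aE] := hull_coefs FA (fun=> oner_neq0 k).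
suff <- : fsupport a = A by rewrite -fsupport_mono1M; exact: hahn_mul.
apply/seteqP; split=> h; rewrite /fsupport /mkset aE; case: asboolP => //.
  by rewrite eqxx.
by rewrite oner_neq0.
Qed.

(** [0] is removed from [A] because the geometric series only makes sense for
    a series supported in the positive elements; the finite sums stay the
    same. *)
Lemma hahn_sums A : F A -> A `<=` [set g | 0 <= g] -> F (finite_sums A).
Proof.
move=> FA A0; have FA' : F (A `\ 0) by apply: hahn_subset FA _ => g [].
have A'pos : A `\ 0 `<=` [set g | 0 < g].
  by move=> g [/A0 /= g0 /eqP gn0]; rewrite lt_neqAle eq_sym gn0.
have [e Fe eE] := hull_coefs FA' (fun=> oner_neq0 k).
have eA : fsupport e `<=` A `\ 0.
  by move=> g; rewrite /fsupport /mkset eE; case: asboolP => //; rewrite eqxx.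
have [b bS eb] := gps_geometric (subset_trans eA A'pos).
have bS' := subset_trans bS (finite_sums_sub eA).
rewrite -finite_sumsD10.
rewrite -(fsupport_geometric k_pchar0 (F_wo FA') A'pos eE eb bS').
have e1 : 1 - e != 0.
  by apply/eqP => e1; move/eqP: eb; rewrite e1 mul0r eq_sym oner_eq0.
have -> : b = 1 / (1 - e) by apply: (mulfI e1); rewrite eb div1r divff.
by apply: hahn_div => //; exact: hahn_sub.
Qed.

Lemma rayner_of_hahn_field : rayner_field_family F.
Proof.
split.
- exact: hahn_subset.
- exact: hahn_setU.
- by exists [set 0]; exact: hahn_set1.
- apply/seteqP; split=> // g _ H [_ sH]; apply: sH; exists [set g] => //.
  exact: hahn_set1.
- exact: hahn_translate.
- exact: hahn_sums.
Qed.

End HahnToRayner.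

(** * Rayner fields and Hahn fields *)

Theorem theorem3p18 (k : fieldType) (hk : [pchar k] =i pred0) (G : oagType)
    (F : set (set G)) (hF : forall A : set G, F A -> well_ordered A) :
  rayner_field_family F <-> hahn_field (hull k F).
Proof.
split; first exact: hahn_field_of_rayner.
exact: rayner_of_hahn_field.
Qed.
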